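(* Let $F$ be a free semilattice and let $\mathbf S$ be a finite system of $F$-equations in variables $x_1,\dots,x_n$. Let $\mathrm{Core}(\mathbf S)\subseteq \mathbf S$ be the core of $\mathbf S$ and suppose (renumbering the variables if necessary) that the variables occurring in $\mathrm{Core}(\mathbf S)$ are $x_1,\dots,x_k$ ($k\le n$). Let $\mathbf S_0=\mathbf S\setminus\mathrm{Core}(\mathbf S)$. Then: 1. the solution set $V_F(\mathrm{Core}(\mathbf S))\subseteq F^k$ is finite, and moreover it can be found algorithmically; 2. $\mathbf S$ is consistent if and only if $\mathrm{Core}(\mathbf S)$ is consistent; 3. if $V_F(\mathrm{Core}(\mathbf S))=\{P_1,\dots,P_m\}$ with $P_i=(p_{i1},p_{i2},\dots,p_{ik})$, then $$V_F(\mathbf S)=\bigcup_{i=1}^m V_F\Bigl(\mathbf S_0\cup\bigcup_{j=1}^k\{x_j=p_{ij}\}\Bigr).$$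
   Context: A semilattice is a commutative idempotent semigroup. $F$ is the free semilattice with free generators $\{a_i\mid i\in I\}$; each element has a unique normal form as a finite nonempty product of distinct generators, and for algorithmic purposes elements are given by their normal forms. For $X=\{x_1,\dots,x_n\}$, an $F$-term is an expression $w(X)a$, $w(X)$ or $a$, where $w(X)$ is a nonempty product of variables and $a\in F$ (an element of the free product of $F$ and the free semilattice on $X$). An $F$-equation is a formal equality of two $F$-terms. $V_F(\cdot)$ denotes the solution set, over $F$, of a system (set of $F$-equations); a system is consistent if its solution set is nonempty. The core of a finite system $\mathbf S$ is the result of the following procedure (Procedure I). Start with $Sys=\emptyset$ (a set of equations) and $C=\emptyset$ (a set of variables). At each step let $\mathbf S'$ be the set of all equations $\sigma(X)=\tau(X)$ of $\mathbf S$, not yet in $Sys$, such that, after possibly interchanging the two sides, $\tau(X)$ is either a constant (an element of $F$) or all variables occurring in $\tau(X)$ belong to $C$. If $\mathbf S'=\emptyset$, terminate. Otherwise add to $C$ all variables that occur in $\mathbf S'$, add $\mathbf S'$ to $Sys$, and go to the next step. The final set $Sys$ is $\mathrm{Core}(\mathbf S)$, and the final set $C$ is the set of variables occurring in it. *)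

(* Defs.v *)
From Stdlib Require List.
From HB Require Import structures.
From mathcomp Require Import all_boot finmap.
From mathcomp Require Import boolp classical_sets functions cardinality.

Set Implicit Arguments.
Unset Strict Implicit.
Unset Printing Implicit Defensive.

Local Open Scope group_scope.

HB.mixin Record Semigroup_isSemilattice F of Semigroup F := {
  mulslC : commutative (@mul F);
  mulslxx : idempotent_op (@mul F)
}.

#[short(type="semilatticeType")]
HB.structure Definition Semilattice :=
  {F of Semigroup_isSemilattice F & Semigroup F}.

Definition free_semilattice (I : Type) (F : semilatticeType) (a : I -> F) :=
  forall (L : semilatticeType) (f : I -> L),
    exists h : {multiplicative F -> L}, h \o a =1 f /\
      forall h' : {multiplicative F -> L}, h' \o a =1 f -> h' =1 h.

(* A semigroup has no empty product, whence the option. *)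
Definition sprod (F : semigroupType) (s : seq F) : option F :=
  if s is x :: s' then Some (foldl mul x s') else None.

Section Equations.
Variables (X : finType) (F : semilatticeType).

(* The term w(X)a is (W, Some a), w(X) is (W, None) and a is (set0, Some a):
   a product w(X) in the free semilattice on X is its nonempty set W of
   factors, and only the pair (set0, None) is not a term. *)
Record fterm := FTerm {
  term_val : {set X} * option F;
  _ : (term_val.1 != finset.set0) || isSome term_val.2
}.
HB.instance Definition _ := [isSub of fterm for term_val].
HB.instance Definition _ := [Choice of fterm by <:].

Definition term_vars (t : fterm) : {set X} := (val t).1.
Definition term_coef (t : fterm) : option F := (val t).2.
Definition is_constant (t : fterm) : bool := term_vars t == finset.set0.

Definition equation : Type := fterm * fterm.
HB.instance Definition _ := Choice.on equation.

Definition eq_vars (e : equation) : {set X} :=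
  term_vars e.1 :|: term_vars e.2.

(* Never None, as a term has at least one factor. *)
Definition term_eval (p : {ffun X -> F}) (t : fterm) : option F :=
  sprod ([seq p x | x <- enum (term_vars t)] ++ seq_of_opt (term_coef t)).

Definition solves (p : {ffun X -> F}) (e : equation) : Prop :=
  term_eval p e.1 = term_eval p e.2.

Definition solutions (S : set equation) : set {ffun X -> F} :=
  [set p | forall e, S e -> solves p e]%classic.

Definition consistent (S : set equation) : Prop := (solutions S !=set0)%classic.

Fact var_term_subproof (x : X) :
  (([set x] : {set X}) != finset.set0) || isSome (@None F).
Proof. by rewrite orbF; apply/set0Pn; exists x; rewrite inE. Qed.

Definition var_term (x : X) : fterm :=
  @FTerm ([set x]%SET, None) (var_term_subproof x).

Definition const_term (c : F) : fterm :=
  @FTerm (finset.set0, Some c) (orbT _).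

Definition var_eq_const (x : X) (c : F) : equation :=
  (var_term x, const_term c).

End Equations.

Section RenameVariables.
Variables (Y X : finType) (F : semilatticeType) (v : Y -> X).

Fact term_rename_subproof (t : fterm Y F) :
  ((v @: term_vars t)%SET != finset.set0) || isSome (term_coef t).
Proof.
case/orP: (valP t) => [/set0Pn[y ty]|->]; last by rewrite orbT.
by apply/orP; left; apply/set0Pn; exists (v y); apply: imset_f.
Qed.

Definition term_rename (t : fterm Y F) : fterm X F :=
  @FTerm X F ((v @: term_vars t)%SET, term_coef t) (term_rename_subproof t).

Definition eq_rename (e : equation Y F) : equation X F :=
  (term_rename e.1, term_rename e.2).

End RenameVariables.

Section Core.
Variables (n : nat) (F : semilatticeType).
Local Notation eqn := (equation 'I_n F).
Implicit Types (S Sys : {fset eqn}) (C : {set 'I_n}) (st : {fset eqn} * {set 'I_n}).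
Local Open Scope fset_scope.

Definition side_known C (t : fterm 'I_n F) : bool :=
  is_constant t || (term_vars t \subset C).

Definition core_new S st : {fset eqn} :=
  [fset e in S | (e \notin st.1) && (side_known st.2 e.1 || side_known st.2 e.2)].

Definition core_step S st : {fset eqn} * {set 'I_n} :=
  (st.1 `|` core_new S st,
   st.2 :|: \bigcup_(e <- core_new S st) eq_vars e)%SET.

(* Each step that does not terminate the procedure adds an equation to Sys, so
   #|S| steps reach the final state, see core_run_final; further steps would
   leave it unchanged. *)
Definition core_run S : {fset eqn} * {set 'I_n} :=
  iter #|` S| (core_step S) (fset0, finset.set0).

Definition core S : {fset eqn} := (core_run S).1.
Definition core_vars S : {set 'I_n} := (core_run S).2.

Lemma core_run_final S : core_new S (core_run S) = fset0.
Proof.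
pose st m := iter m (core_step S) (fset0, finset.set0).
have sub m : (st m).1 `<=` S.
  elim: m => [|m IH] /=; first exact: fsub0set.
  rewrite fsubUset IH /=; apply/fsubsetP => e.
  by rewrite !inE => /andP[].
have stop m : core_new S (st m) = fset0 -> core_new S (st m.+1) = fset0.
  move=> h; suff -> : st m.+1 = st m by [].
  rewrite /st iterS -/(st m) /core_step h fsetU0 big_seq_fset0 finset.setU0.
  by case: (st m).
have grow m : core_new S (st m) = fset0 \/ m < #|` (st m.+1).1|.
  elim: m => [|m [/stop|IH]]; last 1 first.
  - case: (core_new S (st m.+1) =P fset0) => [|/eqP/fset0Pn[e he]]; first by left.
    right.
    apply: leq_ltn_trans IH _; apply: fproper_ltn_card.
    rewrite fproperEneq; apply/andP; split; last exact: fsubsetUl.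
    apply/eqP => E; have : e \in (st m.+1).1 by rewrite E in_fsetU he orbT.
    by apply/negP; move: he; rewrite !inE /= => /andP[_ /andP[]].
  - case: (core_new S (st 0) =P fset0) => [|/eqP/fset0Pn[e he]]; [by left|right].
    by rewrite cardfs_gt0; apply/fset0Pn; exists e; rewrite in_fsetU he orbT.
  - by left.
case: (grow #|` S|) => // /leq_trans/(_ (fsubset_leq_card (sub _))).
by rewrite ltnn.
Qed.

(* The variables of the core, in increasing order: this is the renumbering
   under which they become x_1, ..., x_k with k = #|core_vars S|. *)
Definition core_var S (j : 'I_#|core_vars S|) : 'I_n := enum_val j.

(* The core as a system in its own k variables only. *)
Definition core_system S : set (equation 'I_#|core_vars S| F) :=
  [set e | eq_rename (@core_var S) e \in core S]%classic.

End Core.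
Arguments core_var {n F} S j.
Arguments core_system {n F} S.

(* The model of computation is the one-variable while language over binary
   trees (the language I of N. Jones, Computability and Complexity, 1997),
   which is Turing complete. The input is the initial value of the variable and
   the output its final value; leaf is the only false value. *)
Inductive tree : Type := leaf | node of tree & tree.

Inductive expr : Type :=
| EVar | ELeaf | ENode of expr & expr | EHead of expr | ETail of expr.

Fixpoint expr_eval (x : tree) (e : expr) : tree :=
  match e with
  | EVar => x
  | ELeaf => leaf
  | ENode e1 e2 => node (expr_eval x e1) (expr_eval x e2)
  | EHead e1 => if expr_eval x e1 is node l _ then l else leaf
  | ETail e1 => if expr_eval x e1 is node _ r then r else leaf
  end.

Inductive program : Type :=
| Assign of expr | Then of program & program | While of expr & program.

Inductive exec : program -> tree -> tree -> Prop :=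
| exec_assign e x : exec (Assign e) x (expr_eval x e)
| exec_seq c1 c2 x y z : exec c1 x y -> exec c2 y z -> exec (Then c1 c2) x z
| exec_while_stop e c x : expr_eval x e = leaf -> exec (While e c) x x
| exec_while_loop e c x y z : expr_eval x e <> leaf ->
    exec c x y -> exec (While e c) y z -> exec (While e c) x z.

Definition encode_nat (m : nat) : tree := iter m (node leaf) leaf.
Definition encode_pair A B (f : A -> tree) (g : B -> tree) (p : A * B) : tree :=
  node (f p.1) (g p.2).
Definition encode_seq A (f : A -> tree) (s : seq A) : tree :=
  foldr (fun x => node (f x)) leaf s.

(* Words: the number i < r denotes the generator a (g i), where g lists r
   distinct generators among which those used by the system must be; a term is
   written as the list of its variables and the word of its coefficient, either
   of which may be absent (empty). *)
Definition word r : Type := seq 'I_r.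
Definition wterm n r : Type := seq 'I_n * word r.
Definition wequation n r : Type := wterm n r * wterm n r.
Definition wsystem n r : Type := seq (wequation n r).

Definition encode_word r : word r -> tree :=
  encode_seq (fun i : 'I_r => encode_nat i).
Definition encode_term n r : wterm n r -> tree :=
  encode_pair (encode_seq (fun x : 'I_n => encode_nat x)) (@encode_word r).
Definition encode_system n r : wsystem n r -> tree :=
  encode_seq (encode_pair (@encode_term n r) (@encode_term n r)).
Definition encode_points r : seq (seq (word r)) -> tree :=
  encode_seq (encode_seq (@encode_word r)).

Section NormalForms.
Variables (I : Type) (F : semilatticeType) (a : I -> F).
Variables (r : nat) (g : 'I_r -> I).

Definition word_val (w : word r) : option F := sprod [seq a (g i) | i <- w].

Definition normal_form (w : word r) (c : F) : Prop :=
  uniq w /\ word_val w = Some c.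

Definition term_normal_form n (w : wterm n r) (t : fterm 'I_n F) : Prop :=
  [/\ uniq w.1, [set x in w.1]%SET = term_vars t,
      uniq w.2 & word_val w.2 = term_coef t].

Definition equation_normal_form n (w : wequation n r) (e : equation 'I_n F) :
    Prop :=
  term_normal_form w.1 e.1 /\ term_normal_form w.2 e.2.

Definition system_normal_form n (w : wsystem n r) (S : {fset equation 'I_n F}) :
    Prop :=
  exists2 es : seq (equation 'I_n F),
    S = [fset e in es]%fset & List.Forall2 (@equation_normal_form n) w es.

Definition point_normal_form k (w : seq (word r)) (P : {ffun 'I_k -> F}) : Prop :=
  List.Forall2 normal_form w [seq P j | j <- enum 'I_k].

End NormalForms.

(* Given any presentation of S by normal forms, the program c halts with a
   finite list of normal forms that enumerates the solutions of the core. *)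
Definition finds_core_solutions (I : Type) (F : semilatticeType) (a : I -> F)
    (c : program) n (S : {fset equation 'I_n F}) : Prop :=
  forall (r : nat) (g : 'I_r -> I) (w : wsystem n r),
    injective g -> system_normal_form a g w S ->
    exists (out : seq (seq (word r)))
           (Ps : seq {ffun 'I_#|core_vars S| -> F}),
      [/\ exec c (encode_system w) (encode_points out),
          List.Forall2 (@point_normal_form I F a r g _) out Ps
        & solutions (core_system S) = [set` Ps]%classic].

(* Main.v *)
From HB Require Import structures.
Require Import Defs.
From mathcomp Require Import all_boot finmap.
From mathcomp Require Import boolp classical_sets functions cardinality.

Set Implicit Arguments.
Unset Strict Implicit.
Unset Printing Implicit Defensive.

(** An element of a free semilattice is determined by the finite nonempty set
of generators that occur in it ([occurs_inj]), and the set of a product is the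
union of the sets of its factors.  An equation therefore says, for each
generator separately, that it occurs on the left exactly when it occurs on the
right ([solvesP]).

Finiteness.  If every generator of one side of an equation lies in a set [K],
then so does every generator of the other side, hence every generator of the
value of a variable there.  Taking for [K] the generators of the constants of the core and
following the procedure equation by equation, one finds that in a solution the
values of all core variables have their generators in [K]
([core_solution_bound]); as [K] is finite, there are finitely many such values.

Consistency.  An equation outside the core has, on each of its sides, a
variable outside the core, since otherwise the procedure would have admitted
it.  Given a solution of the core, let all the other variables take one and the
same value [c], chosen so that it contains every generator of the constants and
of the given solution.  Both sides of an equation outside the core then become
[c] ([consistent_core]).  The description of all solutions
([solutions_split]) holds because the restriction of a solution to the core
variables solves the core.

Computability.  The bound also gives an algorithm: assign to the core variables
all nonempty subwords of the word of generators that occur in the system, and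
keep the assignments that satisfy the core ([core_points]).  To obtain a
program, one shows that the functions on encoded data that programs compute are
closed under composition, pairing and folding over a list; the search is a
combination of these operations ([computable_core_points]).  Its correctness,
in both directions, is [point_val_solution] and [solution_point_val]. *)

(** * Functions computed by programs *)

(** Data types with their encoding, so that the encodings of compound data are
inferred and [computable] can be stated for functions between plain types. *)
Structure codeType := CodeType { carrier :> Type; encode : carrier -> tree }.
Arguments encode {c} x.

Canonical unit_code := @CodeType unit (fun=> leaf).
Canonical nat_code := CodeType encode_nat.
Canonical bool_code := @CodeType bool (fun b => encode_nat b).
Canonical prod_code (A B : codeType) :=
  CodeType (encode_pair (@encode A) (@encode B)).
Canonical seq_code (A : codeType) := CodeType (encode_seq (@encode A)).

Definition computable (E A : codeType) (f : E -> A) : Prop :=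
  exists c, forall x, exec c (encode x) (encode (f x)).

(** [expr_on_head] and [on_head] make code act on the head of the variable and
preserve its tail.  This is how a value, such as the input when a pair is
computed, survives in the single variable while something else is computed. *)
Fixpoint expr_on_head (e : expr) : expr :=
  match e with
  | EVar => EHead EVar
  | ELeaf => ELeaf
  | ENode e1 e2 => ENode (expr_on_head e1) (expr_on_head e2)
  | EHead e1 => EHead (expr_on_head e1)
  | ETail e1 => ETail (expr_on_head e1)
  end.

Fixpoint on_head (c : program) : program :=
  match c with
  | Assign e => Assign (ENode (expr_on_head e) (ETail EVar))
  | Then c1 c2 => Then (on_head c1) (on_head c2)
  | While e c1 => While (expr_on_head e) (on_head c1)
  end.

Lemma expr_on_headE x z e :
  expr_eval (node x z) (expr_on_head e) = expr_eval x e.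
Proof.
by elim: e => //= [e1 -> e2 ->|e -> |e ->].
Qed.

Lemma exec_on_head c x y z :
  exec c x y -> exec (on_head c) (node x z) (node y z).
Proof.
elim=> {c x y} /= [e x|c1 c2 x y t _ IH1 _ IH2|e c x ex
                  |e c x y t ex _ IH1 _ IH2].
- have := exec_assign (ENode (expr_on_head e) (ETail EVar)) (node x z).
  by rewrite /= expr_on_headE.
- exact: exec_seq IH1 IH2.
- by apply: exec_while_stop; rewrite expr_on_headE.
- by apply: exec_while_loop IH1 IH2; rewrite expr_on_headE.
Qed.

Lemma computable_expr (E A : codeType) (f : E -> A) e :
  (forall x, encode (f x) = expr_eval (encode x) e) -> computable f.
Proof.
by move=> fe; exists (Assign e) => x; rewrite fe; apply: exec_assign.
Qed.

Lemma computable_comp (E A B : codeType) (g : A -> B) (f : E -> A) :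
  computable g -> computable f -> computable (fun x => g (f x)).
Proof.
move=> [d dg] [c cf]; exists (Then c d) => x; exact: exec_seq (cf x) (dg _).
Qed.

Lemma computable_id (E : codeType) : computable (fun x : E => x).
Proof. exact: (@computable_expr _ _ _ EVar). Qed.

Lemma computable_const (E A : codeType) (a : A) : computable (fun _ : E => a).
Proof.
have [e et] : exists e, forall x, expr_eval x e = encode a.
  elim: (encode a) => [|t1 [e1 e1P] t2 [e2 e2P]]; first by exists ELeaf.
  by exists (ENode e1 e2) => x /=; rewrite e1P e2P.
by apply: (@computable_expr _ _ _ e) => x; rewrite et.
Qed.

Lemma computable_pair (E A B : codeType) (f : E -> A) (g : E -> B) :
  computable f -> computable g -> computable (fun x => (f x, g x)).
Proof.
move=> [c cf] [d dg].
pose swap := Assign (ENode (ETail EVar) (EHead EVar)).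
exists (Then (Assign (ENode EVar EVar))
       (Then (on_head c) (Then swap (Then (on_head d) swap)))) => x.
apply: exec_seq (exec_assign _ _) _ => /=.
apply: exec_seq (exec_on_head _ (cf x)) _.
apply: exec_seq (exec_assign _ _) _ => /=.
apply: exec_seq (exec_on_head _ (dg x)) _.
exact: exec_assign (ENode (ETail EVar) (EHead EVar)) _.
Qed.

Lemma computable_fst (E A B : codeType) (f : E -> A * B) :
  computable f -> computable (fun x => (f x).1).
Proof.
by apply: computable_comp; apply: (@computable_expr _ _ _ (EHead EVar)).
Qed.

Lemma computable_snd (E A B : codeType) (f : E -> A * B) :
  computable f -> computable (fun x => (f x).2).
Proof.
by apply: computable_comp; apply: (@computable_expr _ _ _ (ETail EVar)).
Qed.

Lemma computable_cons (E A : codeType) (f : E -> A) (s : E -> seq A) :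
  computable f -> computable s -> computable (fun x => f x :: s x).
Proof.
move=> cf cs; have cp : computable (fun p : A * seq A => p.1 :: p.2).
  by apply: (@computable_expr _ _ _ EVar).
exact: (computable_comp cp (computable_pair cf cs)).
Qed.

Lemma computable_succ (E : codeType) (f : E -> nat) :
  computable f -> computable (fun x => (f x).+1).
Proof.
by apply: computable_comp; apply: (@computable_expr _ _ _ (ENode ELeaf EVar)).
Qed.

Lemma computable_pred (E : codeType) (f : E -> nat) :
  computable f -> computable (fun x => (f x).-1).
Proof.
apply: computable_comp; apply: (@computable_expr _ _ _ (ETail EVar)).
by case.
Qed.

(** This is the only place where a loop is used.  The state of the loop is the
rest of the list, the accumulator and the environment [x]; the loop test is the
rest of the list itself, as [leaf], the code of the empty list, is the only
false value. *)
Lemma computable_foldl (E A B : codeType) (f : E -> B -> A -> B)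
    (b : E -> B) (s : E -> seq A) :
  computable (fun t : E * (B * A) => f t.1 t.2.1 t.2.2) ->
  computable b -> computable s ->
  computable (fun x => foldl (f x) (b x) (s x)).
Proof.
move=> cf cb cs.
pose body (t : (A * seq A) * (B * E)) :=
  (t.1.2, (f t.2.2 t.2.1 t.1.1, t.2.2)).
have [c cbody] : computable body.
  apply: computable_pair.
    exact/computable_snd/computable_fst/computable_id.
  apply: computable_pair; last first.
    exact/computable_snd/computable_snd/computable_id.
  apply: (computable_comp (f := fun t : (A * seq A) * (B * E) =>
                                  (t.2.2, (t.2.1, t.1.1))) cf).
  apply: computable_pair.
    exact/computable_snd/computable_snd/computable_id.
  apply: computable_pair.
    exact/computable_fst/computable_snd/computable_id.
  exact/computable_fst/computable_fst/computable_id.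
have [d cinit] : computable (fun x => (s x, (b x, x))).
  by apply: computable_pair => //; apply: computable_pair => //;
     apply: computable_id.
exists (Then d (Then (While (EHead EVar) c)
                     (Assign (EHead (ETail EVar))))) => x.
apply: exec_seq (cinit x) _.
apply: (@exec_seq _ _ _
  (encode (([::] : seq A, (foldl (f x) (b x) (s x), x))))); last first.
  exact: exec_assign (EHead (ETail EVar)) _.
elim: (s x) (b x) => [|y l IH] v /=; first exact: exec_while_stop.
apply: exec_while_loop (IH _) => //.
exact: cbody ((y, l), (v, x)).
Qed.

Lemma computable_rev (E A : codeType) (s : E -> seq A) :
  computable s -> computable (fun x => rev (s x)).
Proof.
apply: (@computable_comp _ _ _ rev).
have -> : @rev A = fun s => foldl (fun l y => y :: l) [::] s.
  apply/funext => l; rewrite -[l in RHS]revK foldl_rev.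
  by elim: (rev l) => //= y t <-.
apply: (@computable_foldl (seq_code A) _ _ (fun=> _) (fun=> _) id).
- apply: computable_cons.
    exact/computable_snd/computable_snd/computable_id.
  exact/computable_fst/computable_snd/computable_id.
- exact: computable_const.
- exact: computable_id.
Qed.

Lemma computable_foldr (E A B : codeType) (f : E -> A -> B -> B)
    (b : E -> B) (s : E -> seq A) :
  computable (fun t : E * (B * A) => f t.1 t.2.2 t.2.1) ->
  computable b -> computable s ->
  computable (fun x => foldr (f x) (b x) (s x)).
Proof.
move=> cf cb cs.
have -> : (fun x => foldr (f x) (b x) (s x)) =
          fun x => foldl (fun y z => f x z y) (b x) (rev (s x)).
  by apply/funext => x; rewrite foldl_rev.
apply: (computable_foldl (f := fun x y z => f x z y)) => //.
exact: computable_rev.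
Qed.

(** A number and a list of as many units have the same code. *)
Lemma computable_iter (E B : codeType) (n : E -> nat) (f : E -> B -> B)
    (b : E -> B) :
  computable n -> computable (fun t : E * B => f t.1 t.2) -> computable b ->
  computable (fun x => iter (n x) (f x) (b x)).
Proof.
move=> cn cf cb.
have -> : (fun x => iter (n x) (f x) (b x)) =
          fun x => foldr (fun (_ : unit) => f x) (b x) (nseq (n x) tt).
  by apply/funext => x; elim: (n x) => //= m ->.
apply: (@computable_foldr E unit_code B (fun x _ => f x)) => //.
  apply: (@computable_comp _ _ _ (fun t : E * B => f t.1 t.2)
            (fun t : E * (B * unit) => (t.1, t.2.1))) => //.
  apply: computable_pair; first exact/computable_fst/computable_id.
  exact/computable_fst/computable_snd/computable_id.
apply: (@computable_comp _ nat_code _ (fun m => nseq m tt)) => //.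
apply: (@computable_expr _ _ _ EVar) => m /=.
by elim: m => //= m ->.
Qed.

(** As a Boolean is coded by a number, a conditional is an iteration of length
at most one; both branches are evaluated, which is harmless for total
functions. *)
Lemma computable_if (E A : codeType) (b : E -> bool) (f g : E -> A) :
  computable b -> computable f -> computable g ->
  computable (fun x => if b x then f x else g x).
Proof.
move=> cb cf cg.
have -> : (fun x => if b x then f x else g x) =
          fun x => iter (b x) (fun=> f x) (g x).
  by apply/funext => x; case: (b x).
have cn : computable nat_of_bool by exact: (@computable_expr _ _ _ EVar).
apply: (computable_iter (f := fun x _ => f x) (computable_comp cn cb) _ cg).
exact/(computable_comp cf)/computable_fst/computable_id.
Qed.

(** Goals are dispatched on the head symbol of the function, because an attempt
to unify with the conclusions of all the closure lemmas in turn, whose functions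
are higher-order variables, need not terminate. *)
Ltac computable_step :=
  cbv beta; lazymatch goal with
  | |- @computable _ _ ?f =>
    first
    [ assumption
    | lazymatch f with
      | (fun x => x) => apply: computable_id
      | (fun=> ?c) => apply: computable_const
      | (fun x => (_, _)) => apply: computable_pair
      | @fst _ _ => apply: (computable_fst (f := id))
      | @snd _ _ => apply: (computable_snd (f := id))
      | (fun x => fst _) => apply: computable_fst
      | (fun x => snd _) => apply: computable_snd
      | (fun x => cons _ _) => apply: computable_cons
      | (fun x => S _) => apply: computable_succ
      | (fun x => predn _) => apply: computable_pred
      | (fun x => if _ then _ else _) => apply: computable_if
      | (fun x => iter _ _ _) => apply: computable_iter
      | (fun x => foldr _ _ _) => apply: computable_foldr
      end ]
  end.

Lemma computable_nilp (E A : codeType) (s : E -> seq A) :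
  computable s -> computable (fun x => nilp (s x)).
Proof.
move=> cs.
have -> : (fun x => nilp (s x)) = fun x => foldr (fun _ _ => false) true (s x).
  by apply/funext => x; case: (s x).
by repeat computable_step.
Qed.

Lemma computable_andb (E : codeType) (b c : E -> bool) :
  computable b -> computable c -> computable (fun x => b x && c x).
Proof.
by move=> cb cc; apply: computable_if => //; apply: computable_const.
Qed.

Lemma computable_orb (E : codeType) (b c : E -> bool) :
  computable b -> computable c -> computable (fun x => b x || c x).
Proof.
by move=> cb cc; apply: computable_if => //; apply: computable_const.
Qed.

Lemma computable_negb (E : codeType) (b : E -> bool) :
  computable b -> computable (fun x => ~~ b x).
Proof. by move=> cb; apply: computable_if => //; apply: computable_const. Qed.

(** Subtraction is the iterated predecessor, which decides [m <= n]. *)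
Lemma computable_eqn (E : codeType) (m n : E -> nat) :
  computable m -> computable n -> computable (fun x => m x == n x).
Proof.
have leq_iter k l :
    (k <= l) = iter (iter l predn k) (fun=> false) true.
  by rewrite iter_predn /leq; case: (k - l).
have cle (k l : E -> nat) : computable k -> computable l ->
    computable (fun x => iter (iter (l x) predn (k x)) (fun=> false) true).
  by move=> ck cl; repeat computable_step.
move=> cm cn.
have -> : (fun x => m x == n x) = (fun x => (m x <= n x) && (n x <= m x)).
  by apply/funext => x; rewrite eqn_leq.
have -> : (fun x => (m x <= n x) && (n x <= m x)) = (fun x =>
    iter (iter (n x) predn (m x)) (fun=> false) true
    && iter (iter (m x) predn (n x)) (fun=> false) true).
  by apply/funext => x; rewrite !leq_iter.
by apply: computable_andb; apply: cle.
Qed.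

Lemma computable_cat (E A : codeType) (s t : E -> seq A) :
  computable s -> computable t -> computable (fun x => s x ++ t x).
Proof.
move=> cs ct.
have -> : (fun x => s x ++ t x) = fun x => foldr cons (t x) (s x).
  by apply/funext => x; elim: (s x) => //= y l ->.
by repeat computable_step.
Qed.

Lemma computable_flatten (E A : codeType) (s : E -> seq (seq A)) :
  computable s -> computable (fun x => flatten (s x)).
Proof.
move=> cs; rewrite /flatten; apply: computable_foldr => //.
  by apply: computable_cat; repeat computable_step.
exact: computable_const.
Qed.

Section ListOperations.
Variables (E A B : codeType) (s : E -> seq A).
Hypothesis cs : computable s.

Lemma computable_size : computable (fun x => size (s x)).
Proof.
have -> : (fun x => size (s x)) = fun x => foldr (fun=> S) 0 (s x).
  by apply/funext => x; elim: (s x) => //= y l ->.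
by repeat computable_step.
Qed.

Lemma computable_map (f : E -> A -> B) :
  computable (fun t : E * A => f t.1 t.2) ->
  computable (fun x => [seq f x y | y <- s x]).
Proof.
move=> cf.
have -> : (fun x => [seq f x y | y <- s x]) =
          fun x => foldr (fun y l => f x y :: l) [::] (s x).
  by apply/funext => x; elim: (s x) => //= y l ->.
repeat computable_step.
apply: (computable_comp (f := fun t : E * (seq B * A) => (t.1, t.2.2)) cf).
by repeat computable_step.
Qed.

Variables (p : E -> A -> bool).
Hypothesis cp : computable (fun t : E * A => p t.1 t.2).

Lemma computable_filter : computable (fun x => [seq y <- s x | p x y]).
Proof.
have -> : (fun x => [seq y <- s x | p x y]) =
    fun x => foldr (fun y l => if p x y then y :: l else l) [::] (s x).
  by apply/funext => x; elim: (s x) => //= y l ->.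
repeat computable_step.
apply: (computable_comp (f := fun t : E * (seq A * A) => (t.1, t.2.2)) cp).
by repeat computable_step.
Qed.

Lemma computable_all : computable (fun x => all (p x) (s x)).
Proof.
have -> : (fun x => all (p x) (s x)) =
    fun x => foldr (fun y b => if p x y then b else false) true (s x).
  by apply/funext => x; elim: (s x) => //= y l ->.
repeat computable_step.
apply: (computable_comp (f := fun t : E * (bool * A) => (t.1, t.2.2)) cp).
by repeat computable_step.
Qed.

End ListOperations.

Lemma computable_mem (E : codeType) (n : E -> nat) (s : E -> seq nat) :
  computable n -> computable s -> computable (fun x => n x \in s x).
Proof.
move=> cn cs.
have -> : (fun x => n x \in s x) =
          fun x => foldr (fun y b => (n x == y) || b) false (s x).
  by apply/funext => x; elim: (s x) => //= y l <-.
apply: computable_foldr => //; last exact: computable_const.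
apply: computable_orb; last by repeat computable_step.
apply: computable_eqn; last by repeat computable_step.
exact/(computable_comp cn)/computable_fst/computable_id.
Qed.

Lemma computable_iota0 (E : codeType) (n : E -> nat) :
  computable n -> computable (fun x => iota 0 (n x)).
Proof.
move=> cn.
have -> : (fun x => iota 0 (n x)) =
    fun x => iter (n x) (fun l => 0 :: [seq y.+1 | y <- l]) [::].
  apply/funext => x; elim: (n x) => //= m <-.
  by rewrite (iotaDl 1).
repeat computable_step.
by apply: computable_map; repeat computable_step.
Qed.

Lemma computable_sumn (E : codeType) (s : E -> seq nat) :
  computable s -> computable (fun x => sumn (s x)).
Proof.
move=> cs.
have -> : (fun x => sumn (s x)) =
          fun x => foldr (fun m k => iter m S k) 0 (s x).
  by apply/funext => x; elim: (s x) => //= m l ->; rewrite iter_succn addnC.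
by repeat computable_step.
Qed.

Ltac computable_list_step :=
  cbv beta; lazymatch goal with
  | |- @computable _ _ ?f =>
    first
    [ assumption
    | lazymatch f with
      | (fun x => nilp _) => apply: computable_nilp
      | (fun x => andb _ _) => apply: computable_andb
      | (fun x => negb _) => apply: computable_negb
      | @size _ => apply: (computable_size (s := id))
      | (fun x => orb _ _) => apply: computable_orb
      | (fun x => cat _ _) => apply: computable_cat
      | (fun x => flatten _) => apply: computable_flatten
      | (fun x => size _) => apply: computable_size
      | (fun x => map _ _) => apply: computable_map
      | (fun x => filter _ _) => apply: computable_filter
      | (fun x => all _ _) => apply: computable_all
      | (fun x => in_mem _ _) => apply: computable_mem
      | (fun x => iota 0 _) => apply: computable_iota0
      | (fun x => sumn _) => apply: computable_sumn
      end
    | computable_step ]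
  end.

(** * The search for the solutions of the core *)

(** Variables and generators are plain numbers here, because one and the same
program has to serve all [n] and [r]. *)
Local Notation coded_equation :=
  ((seq nat * seq nat) * (seq nat * seq nat))%type.

(** A side without variables is a constant, and [all] holds for it. *)
Definition var_sides_known (C : seq nat) (e : coded_equation) : bool :=
  all (fun x => x \in C) e.1.1 || all (fun x => x \in C) e.2.1.

(** One step of the procedure.  Equations that are already in the core are used
again; they contribute nothing new, so that the set of equations need not be
kept. *)
Definition saturate (w : seq coded_equation) (C : seq nat) : seq nat :=
  C ++ flatten [seq e.1.1 ++ e.2.1 | e <- w & var_sides_known C e].

(** Every step but the last one adds an equation, so that [size w] steps
suffice. *)
Definition reached_vars w : seq nat := iter (size w) (saturate w) [::].

(** The upper end of the range only has to exceed all the elements of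
[reached_vars w], as their sum plus one does; the range puts them in increasing
order. *)
Definition sorted_vars w : seq nat :=
  [seq x <- iota 0 (sumn (reached_vars w)).+1 | x \in reached_vars w].

Definition generators (w : seq coded_equation) : seq nat :=
  foldr (fun y l => if y \in l then l else y :: l) [::]
    (flatten [seq e.1.2 ++ e.2.2 | e <- w]).

Definition subwords (s : seq nat) : seq (seq nat) :=
  foldr (fun y l => l ++ [seq y :: u | u <- l]) [:: [::]] s.

Definition assignments (V : seq nat) (U : seq (seq nat)) :
    seq (seq (nat * seq nat)) :=
  foldr (fun v Q => flatten [seq [seq (v, u) :: q | q <- Q] | u <- U])
    [:: [::]] V.

Definition value (q : seq (nat * seq nat)) (t : seq nat * seq nat) : seq nat :=
  flatten [seq b.2 | b <- q & b.1 \in t.1] ++ t.2.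

Definition same_letters (s t : seq nat) : bool :=
  all (fun x => x \in t) s && all (fun x => x \in s) t.

Definition core_points w : seq (seq (seq nat)) :=
  let E := [seq e <- w | var_sides_known (reached_vars w) e] in
  let U := [seq u <- subwords (generators w) | ~~ nilp u] in
  [seq [seq b.2 | b <- q] | q <- assignments (sorted_vars w) U
     & all (fun e => same_letters (value q e.1) (value q e.2)) E].

Lemma computable_core_points : computable core_points.
Proof.
rewrite /core_points /= /same_letters /value /assignments /subwords /generators.
rewrite /sorted_vars /reached_vars /saturate /var_sides_known.
repeat computable_list_step.
Qed.

(** * Free semilattices *)

Definition subsemilattice (F : semilatticeType) (P : {pred F})
    (PM : forall x y, x \in P -> y \in P -> (x * y)%g \in P) : Type :=
  {x | x \in P}.

Section Subsemilattice.
Variables (F : semilatticeType) (P : {pred F}).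
Variable PM : forall x y, x \in P -> y \in P -> (x * y)%g \in P.
Local Notation L := (subsemilattice PM).
HB.instance Definition _ := SubChoice.on L.

Let smul (x y : L) : L := exist (fun z => z \in P) _ (PM (valP x) (valP y)).
Fact smulA : associative smul.
Proof. by move=> x y z; apply/val_inj; rewrite /= mulgA. Qed.
HB.instance Definition _ := isSemigroup.Build L smulA.

Fact smulC : commutative (@mul L).
Proof. by move=> x y; apply/val_inj; rewrite /= mulslC. Qed.
Fact smulxx : idempotent_op (@mul L).
Proof. by move=> x; apply/val_inj; rewrite /= mulslxx. Qed.
HB.instance Definition _ := Semigroup_isSemilattice.Build L smulC smulxx.

Definition inclusion (x : L) : F := val x.
Fact inclusionM : {morph inclusion : x y / (x * y)%g}.
Proof. by []. Qed.
HB.instance Definition _ := isMultiplicative.Build L F inclusion inclusionM.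
End Subsemilattice.

(** The two-element semilattice, whose homomorphisms from a free semilattice
separate the elements. *)
Definition or_bool : Type := bool.
HB.instance Definition _ := Choice.on or_bool.
HB.instance Definition _ := isSemigroup.Build or_bool orbA.
Fact or_boolC : commutative (@mul or_bool). Proof. exact: orbC. Qed.
Fact or_boolxx : idempotent_op (@mul or_bool). Proof. exact: orbb. Qed.
HB.instance Definition _ :=
  Semigroup_isSemilattice.Build or_bool or_boolC or_boolxx.

Section FreeSemilattice.
Variables (I : Type) (F : semilatticeType) (a : I -> F).
Hypothesis F_free : free_semilattice a.

(** The elements that satisfy [P] form a subsemilattice through which [a]
factors; the inclusion composed with the induced homomorphism is the identity on
the generators, hence everywhere, so that every element satisfies [P]. *)
Lemma free_semilattice_ind (P : F -> Prop) :
  (forall i, P (a i)) -> (forall x y, P x -> P y -> P (x * y)%g) ->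
  forall x, P x.
Proof.
move=> Pa PM.
pose Pb : {pred F} := fun x => `[< P x >].
have PbM x y : x \in Pb -> y \in Pb -> (x * y)%g \in Pb.
  by move=> /asboolP Px /asboolP Py; apply/asboolP/PM.
have Pba i : a i \in Pb by apply/asboolP/Pa.
pose b i : subsemilattice PbM := exist (fun z => z \in Pb) _ (Pba i).
have [h [hb _]] := F_free b.
have [k [_ kU]] := F_free a.
pose ih : {multiplicative F -> F} := @inclusion F Pb PbM \o h.
have iha : ih \o a =1 a by move=> i; rewrite /= -[RHS]/(val (b i)) -hb.
move=> x.
have -> : x = val (h x).
  by rewrite -[RHS]/(ih x) (kU ih iha) -(kU idfun (fun=> erefl)).
exact/asboolP/(valP (h x)).
Qed.

(** The homomorphism that sends the generator [i] to true and the others to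
false. *)
Definition occurs (i : I) : {multiplicative F -> or_bool} :=
  projT1 (cid (F_free (fun j => `[< i = j >] : or_bool))).

Lemma occurs_gen i j : occurs i (a j) = `[< i = j >].
Proof.
have [oa _] := projT2 (cid (F_free (fun j => `[< i = j >] : or_bool))).
exact: oa.
Qed.

Lemma occurs_mul i x y : occurs i (x * y)%g = occurs i x || occurs i y.
Proof. by rewrite gmulfM. Qed.

(** The generators of [x] are factors of [y], by which [y] is unchanged, and [x]
is their product.  Uniqueness of normal forms follows by antisymmetry. *)
Lemma mul_absorb x y : (forall i, occurs i x -> occurs i y) -> (x * y)%g = y.
Proof.
have gen_absorb i z : occurs i z -> (a i * z)%g = z.
  elim/free_semilattice_ind: z => [j|z t IHz IHt].
    by rewrite occurs_gen => /asboolP <-; rewrite mulslxx.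
  rewrite occurs_mul => /orP[/IHz zi|/IHt ti]; first by rewrite mulgA zi.
  by rewrite mulgA (mulslC (a i)) -mulgA ti.
elim/free_semilattice_ind: x => [i xy|x z IHx IHz xzy].
  by apply/gen_absorb/xy; rewrite occurs_gen; apply/asboolP.
rewrite -mulgA IHz ?IHx // => i oi; apply: xzy; rewrite occurs_mul oi //.
by rewrite orbT.
Qed.

Lemma occurs_inj x y : (forall i, occurs i x = occurs i y) -> x = y.
Proof.
move=> xy; rewrite -(@mul_absorb x y) => [|i]; last by rewrite xy.
by rewrite mulslC mul_absorb // => i; rewrite xy.
Qed.

Lemma sprod_Some (L : semigroupType) (s : seq L) :
  s != [::] -> exists x, sprod s = Some x.
Proof. by case: s => // x s _; exists (foldl mul x s). Qed.

Lemma occurs_sprod i s x : sprod s = Some x -> occurs i x = has (occurs i) s.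
Proof.
case: s => //= y s [<-].
elim: s y => [|z s IH] y /=; first by rewrite orbF.
by rewrite IH occurs_mul orbA.
Qed.

Lemma gen_word x : exists s, sprod (map a s) = Some x.
Proof.
elim/free_semilattice_ind: x => [i|x y [s sx] [t ty]]; first by exists [:: i].
exists (s ++ t); have [z stz] : exists z, sprod (map a (s ++ t)) = Some z.
  by apply: sprod_Some; case: s sx.
rewrite stz; congr Some; apply: occurs_inj => i.
rewrite (occurs_sprod i stz) map_cat has_cat.
by rewrite -(occurs_sprod i sx) -(occurs_sprod i ty) occurs_mul.
Qed.

(** * Equations, one generator at a time *)

Section Terms.
Variable X : finType.
Implicit Types (p : {ffun X -> F}) (t : fterm X F).

(** The value at [i] of the homomorphism [occurs i] on the term [t] at [p]. *)
Definition term_occurs p t (i : I) : bool :=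
  [exists x in term_vars t, occurs i (p x)]
  || oapp (occurs i) false (term_coef t).

Lemma term_eval_Some p t :
  exists2 c, term_eval p t = Some c & forall i, occurs i c = term_occurs p t i.
Proof.
have [c tc] : exists c, term_eval p t = Some c.
  apply: sprod_Some; rewrite -size_eq0 size_cat size_map -cardE addn_eq0.
  rewrite negb_and cards_eq0; have := valP t.
  rewrite /term_vars /term_coef.
  by case: (val t) => W [d|] //=; rewrite !orbF => ->.
exists c => // i; rewrite (occurs_sprod i tc) has_cat has_map /term_occurs.
congr (_ || _); last by case: term_coef => //= d; rewrite orbF.
apply/hasP/exists_inP => [[x]|[x xt ox]]; last by exists x; rewrite ?mem_enum.
by rewrite mem_enum; exists x.
Qed.

Lemma solvesP p e :
  solves p e <-> forall i, term_occurs p e.1 i = term_occurs p e.2 i.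
Proof.
rewrite /solves; have [c -> oc] := term_eval_Some p e.1.
have [d -> od] := term_eval_Some p e.2.
split => [[cd] i|cd]; first by rewrite -oc -od cd.
by congr Some; apply: occurs_inj => i; rewrite oc od.
Qed.

End Terms.

Lemma solves_rename (Y X : finType) (v : Y -> X) (p : {ffun X -> F}) e :
  solves p (eq_rename v e) <-> solves [ffun y => p (v y)] e.
Proof.
have E t i : term_occurs p (term_rename v t) i
    = term_occurs [ffun y => p (v y)] t i.
  congr (_ || _); apply/exists_inP/exists_inP => [[x]|[y yt]].
    by move=> /imsetP[y yt ->] oy; exists y; rewrite ?ffunE.
  by rewrite ffunE; exists (v y) => //; apply: imset_f.
by rewrite !solvesP; split=> h i; move: (h i); rewrite !E.
Qed.

End FreeSemilattice.

(** * The procedure that computes the core *)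

Section CoreTheory.
Variables (n : nat) (F : semilatticeType).
Implicit Types (S : {fset equation 'I_n F}) (C D : {set 'I_n}).
Implicit Types (e : equation 'I_n F).
Local Open Scope fset_scope.

Definition eq_known C e : bool := side_known C e.1 || side_known C e.2.

Lemma side_knownE C (t : fterm 'I_n F) :
  side_known C t = (term_vars t \subset C).
Proof.
rewrite /side_known /is_constant; case: eqP => //= ->.
by rewrite finset.sub0set.
Qed.

Lemma eq_known_sub C D e : C \subset D -> eq_known C e -> eq_known D e.
Proof.
move=> CD; rewrite /eq_known !side_knownE.
by case/orP => /fintype.subset_trans/(_ CD)->; rewrite ?orbT.
Qed.

Definition stage S m := iter m (core_step S) (fset0, finset.set0).

Lemma stageS S m : stage S m.+1 = core_step S (stage S m).
Proof. by []. Qed.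

Lemma in_core_new S st e :
  (e \in core_new S st) = (e \in S) && ((e \notin st.1) && eq_known st.2 e).
Proof. by rewrite in_fset !inE. Qed.

Lemma stage_stable S m : stage S (#|` S| + m) = core_run S.
Proof.
elim: m => [|m IH]; first by rewrite addn0.
rewrite addnS stageS IH /core_step core_run_final fsetU0.
by rewrite big_seq_fset0 finset.setU0; case: core_run.
Qed.

Lemma stage_sub S m : (stage S m).1 `<=` S.
Proof.
elim: m => [|m IH]; first exact: fsub0set.
rewrite stageS fsubUset IH /=; apply/fsubsetP => e.
by rewrite in_core_new => /andP[].
Qed.

Lemma in_bigcup_eq_vars (s : seq (equation 'I_n F)) x :
  reflect (exists2 e, e \in s & x \in eq_vars e)
          (x \in (\bigcup_(e <- s) eq_vars e)%SET).
Proof.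
elim: s => [|e s IH].
  by rewrite big_nil inE; apply: (iffP idP) => // -[].
rewrite big_cons finset.in_setU; apply: (iffP orP) => [[xe|/IH[d ds xd]]|[d]].
- by exists e => //; rewrite mem_head.
- by exists d => //; rewrite in_cons ds orbT.
- by rewrite in_cons => /orP[/eqP->|ds xd]; [left|right; apply/IH; exists d].
Qed.

Lemma stage_invariant S m e : e \in (stage S m).1 ->
  eq_known (stage S m).2 e && (eq_vars e \subset (stage S m).2).
Proof.
elim: m => [|m IH] //; rewrite stageS.
have sub2 : (stage S m).2 \subset (core_step S (stage S m)).2.
  exact: finset.subsetUl.
rewrite in_fsetU => /orP[/IH/andP[ke ve]|eN].
  by rewrite (eq_known_sub sub2 ke) (fintype.subset_trans ve sub2).
have := eN; rewrite in_core_new => /andP[_ /andP[_ ke]].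
rewrite (eq_known_sub sub2 ke); apply/fintype.subsetP => x xe /=.
by rewrite finset.in_setU; apply/orP; right; apply/in_bigcup_eq_vars; exists e.
Qed.

(** The variables of the next stage do not depend on which equations have been
collected: those of a collected equation are present already. *)
Lemma stage_vars S m x :
  reflect (x \in (stage S m).2 \/
           exists2 e, (e \in S) && eq_known (stage S m).2 e & x \in eq_vars e)
    (x \in (stage S m.+1).2).
Proof.
rewrite stageS finset.in_setU.
apply: (iffP orP) => [[->|]|[->|[e]]]; try by left.
  case/in_bigcup_eq_vars => e; rewrite in_core_new => /andP[eS /andP[_ ke]] xe.
  by right; exists e => //; apply/andP; split.
move=> /andP[eS ke] xe.
have [/stage_invariant/andP[_ /fintype.subsetP/(_ x xe)->]|eN] :=
  boolP (e \in (stage S m).1); first by left.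
by right; apply/in_bigcup_eq_vars; exists e => //; rewrite in_core_new eS eN.
Qed.

(** Membership in the core can be tested at the end: what is known at some stage
remains known, and the final state admits no further equation. *)
Lemma in_core S e : (e \in core S) = (e \in S) && eq_known (core_vars S) e.
Proof.
apply/idP/andP => [eC|[eS ke]].
  by rewrite (fsubsetP (stage_sub S _) _ eC); case/andP: (stage_invariant eC).
have := core_run_final S; move/fsetP/(_ e).
by rewrite in_core_new eS ke andbT in_fset0 => /negbFE.
Qed.

Lemma core_eq_vars S e : e \in core S -> eq_vars e \subset core_vars S.
Proof. by case/stage_invariant/andP. Qed.

(** The induction principle of the procedure.  Its hypothesis ranges over the
equations of the core because it is applied to sets [D] that are described by
means of a solution of the core. *)
Lemma core_vars_min S D :
  (forall e, e \in core S -> eq_known D e -> eq_vars e \subset D) ->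
  core_vars S \subset D.
Proof.
move=> DP.
suff : forall m, m <= #|` S| -> (stage S m).2 \subset D by apply.
elim=> [_|m IH mS]; first by rewrite finset.sub0set.
apply/fintype.subsetP => x /stage_vars[|[e /andP[eS ke] xe]].
  exact/fintype.subsetP/IH/ltnW.
apply: (fintype.subsetP (DP e _ _)) xe; last first.
  exact: eq_known_sub (IH (ltnW mS)) ke.
rewrite in_core eS; apply: eq_known_sub ke.
have mono k : (stage S m).2 \subset (stage S (m + k)).2.
  elim: k => [|k IHk]; first by rewrite addn0.
  by apply: fintype.subset_trans IHk _; rewrite addnS; apply: finset.subsetUl.
by have := mono (#|` S| - m); rewrite subnKC // ltnW.
Qed.

End CoreTheory.

(** * Solutions of the core *)

Section CoreSolutions.
Variables (I : Type) (F : semilatticeType) (a : I -> F).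
Hypothesis F_free : free_semilattice a.
Local Notation occurs := (occurs F_free).
Local Notation term_occurs := (term_occurs F_free).

Lemma occurs_some x : exists i, occurs i x.
Proof.
elim/(free_semilattice_ind F_free): x => [i|x y [i ix] _].
  by exists i; rewrite occurs_gen; apply/asboolP.
by exists i; rewrite occurs_mul ix.
Qed.

(** Normal forms can be chosen inside any given list [s] of generators that
contains those of [x]. *)
Lemma sprod_support (T : eqType) (h : T -> I) (s : seq T) x :
  (forall i, occurs i x -> exists2 l, l \in s & h l = i) ->
  sprod [seq a (h l) | l <- s & occurs (h l) x] = Some x.
Proof.
move=> xs.
have [y sy] : exists y, sprod [seq a (h l) | l <- s & occurs (h l) x] = Some y.
  apply: sprod_Some; have [i ix] := occurs_some x; have [l ls hl] := xs i ix.
  have : l \in [seq l <- s | occurs (h l) x] by rewrite mem_filter hl ix.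
  by case: filter.
rewrite sy; congr Some; apply: (occurs_inj (F_free := F_free)) => i.
rewrite (occurs_sprod F_free i sy) has_map; apply/hasP/idP => [[l]|ix].
  by rewrite mem_filter => /andP[lx _] /=; rewrite occurs_gen => /asboolP ->.
have [l ls hl] := xs i ix.
by exists l; rewrite ?mem_filter /= ?occurs_gen hl ?ix //; apply/asboolP.
Qed.

(** The points in question are the values of [point], which has finitely many
arguments: each coordinate is the product of a set of letters of a fixed word
for [c]. *)
Lemma finite_bounded (k : nat) (c : F) :
  finite_set [set q : {ffun 'I_k -> F} |
    forall j i, occurs i (q j) -> occurs i c]%classic.
Proof.
have [s sc] := gen_word F_free c.
pose h := tnth (in_tuple s).
pose point (B : {ffun 'I_k -> {set 'I_(size s)}}) : {ffun 'I_k -> F} :=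
  [ffun j => odflt c (sprod [seq a (h l) | l <- enum 'I_(size s) & l \in B j])].
apply: (@sub_finite_set _ _ (range point)); last exact: finite_image.
move=> q qc; exists [ffun j => [set l | occurs (h l) (q j)]%SET] => //.
apply/ffunP => j; rewrite !ffunE.
rewrite (eq_filter (a2 := fun l => occurs (h l) (q j))); last first.
  by move=> l; rewrite inE.
rewrite sprod_support // => i /qc; rewrite (occurs_sprod F_free i sc).
case/(has_nthP c) => l; rewrite size_map => ls.
rewrite (nth_map i) // occurs_gen => /asboolP ->.
by exists (Ordinal ls); rewrite ?mem_enum // /h (tnth_nth i).
Qed.

Lemma common_bound (d : F) (s : seq F) :
  exists c, forall x, x \in s -> forall i, occurs i x -> occurs i c.
Proof.
elim: s => [|x s [c IH]]; first by exists d.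
exists (x * c)%g => y; rewrite in_cons => /orP[/eqP->|ys] i oi.
  by rewrite occurs_mul oi.
by rewrite occurs_mul (IH y) // orbT.
Qed.

Variables (n : nat) (S : {fset equation 'I_n F}).
Implicit Types (p : {ffun 'I_n -> F}) (q : {ffun 'I_#|core_vars S| -> F}).
Local Notation V := (core_vars S).

Definition eq_coefs (e : equation 'I_n F) : seq F :=
  seq_of_opt (term_coef e.1) ++ seq_of_opt (term_coef e.2).

(** [restrict] and [extend] translate between points in the [n] variables of
the system and points in the variables of its core. *)
Definition restrict p : {ffun 'I_#|V| -> F} := [ffun j => p (core_var S j)].

Definition extend (d : F) q : {ffun 'I_n -> F} :=
  [ffun x => if [pick j | core_var S j == x] is Some j then q j else d].

Lemma extendK d : cancel (extend d) restrict.
Proof.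
move=> q; apply/ffunP => j; rewrite !ffunE.
case: pickP => [l /eqP/enum_val_inj -> //|noj].
by have := noj j; rewrite /= eqxx.
Qed.

Lemma core_varP x : reflect (exists j, core_var S j = x) (x \in V).
Proof.
apply: (iffP idP) => [xV|[j <-]]; last exact: enum_valP.
by exists (enum_rank_in xV x); rewrite /core_var enum_rankK_in.
Qed.

Lemma core_rename e : e \in core S -> exists e', eq_rename (core_var S) e' = e.
Proof.
move/core_eq_vars => eV.
have ren t : term_vars t \subset V ->
    exists t', term_rename (core_var S) t' = t.
  move=> tV.
  have vW : core_var S @: (core_var S @^-1: term_vars t) = term_vars t.
    apply/setP => x; apply/imsetP/idP => [[j]|xt].
      by rewrite inE => jt ->.
    have /core_varP[j jx] := fintype.subsetP tV x xt.
    by exists j; rewrite ?inE jx.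
  have W : (core_var S @^-1: term_vars t != finset.set0)
      || isSome (term_coef t).
    case: eqP => //= W0; have := valP t; rewrite -/(term_vars t).
    by rewrite -vW W0 imset0 eqxx.
  exists (@FTerm _ _ (core_var S @^-1: term_vars t, term_coef t) W).
  by apply: val_inj => /=; rewrite vW [RHS]surjective_pairing.
move: eV; rewrite finset.subUset => /andP[/ren[t1 e1] /ren[t2 e2]].
by exists (t1, t2); rewrite /eq_rename /= e1 e2; case: (e).
Qed.

Lemma core_solutionsP p :
  solutions (core_system S) (restrict p) <->
  (forall e, e \in core S -> solves p e).
Proof.
split=> [sp e eC|sp e]; last by move=> /sp /(solves_rename F_free).
have [e' ee] := core_rename eC.
by rewrite -ee; apply/(solves_rename F_free)/sp; rewrite /core_system /= ee.
Qed.

(** The closure property needed for [core_vars_min]: if all variables of one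
side have values with generators in [K], then so has that side, hence the other
side, hence each variable of the other side. *)
Lemma core_solution_bound p (K : I -> Prop) :
  (forall e, e \in core S -> solves p e) ->
  (forall e c i, e \in core S -> c \in eq_coefs e -> occurs i c -> K i) ->
  forall x i, x \in V -> occurs i (p x) -> K i.
Proof.
move=> sp cK x i xV.
pose D := [set y | `[< forall i, occurs i (p y) -> K i >]]%SET.
suff /fintype.subsetP/(_ x xV) : V \subset D.
  by rewrite inE => /asboolP; apply.
apply: core_vars_min => e eC.
have eqK t t' : seq_of_opt (term_coef t) ++ seq_of_opt (term_coef t')
      =i eq_coefs e ->
    (forall l, term_occurs p t l = term_occurs p t' l) ->
    term_vars t' \subset D -> eq_vars (t, t') \subset D.
  move=> te tt' t'D; rewrite /eq_vars /= finset.subUset t'D andbT.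
  apply/fintype.subsetP => y yt; rewrite inE; apply/asboolP => l ly.
  have : term_occurs p t l by apply/orP; left; apply/exists_inP; exists y.
  rewrite tt' => /orP[/exists_inP[z zt' lz]|].
    by have := fintype.subsetP t'D z zt'; rewrite inE => /asboolP/(_ l lz).
  case ct: (term_coef t') => [c|] //= lc; apply: (cK e c) => //.
  by rewrite -te ct mem_cat mem_head orbT.
have /(solvesP F_free) se := sp e eC.
rewrite /eq_known !side_knownE => /orP[e1D|e2D]; last first.
  by case: (e) eqK se e2D => ? ? eqK se ?; apply: eqK.
rewrite /eq_vars finset.setUC; apply: (eqK e.2 e.1) => //.
by move=> c; rewrite !mem_cat orbC.
Qed.

Lemma finite_core_solutions :
  inhabited F -> finite_set (solutions (core_system S)).
Proof.
move=> [d].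
have [c cS] := common_bound d (flatten [seq eq_coefs e | e <- enum_fset S]).
apply: sub_finite_set (finite_bounded _ c) => q sq j i.
rewrite -(extendK d q) in sq *; move: sq => /core_solutionsP sq.
rewrite /restrict [X in occurs i X]ffunE.
apply: (core_solution_bound (K := fun l => occurs l c) sq); last first.
  exact: enum_valP.
move=> e b l; rewrite in_core => /andP[eS _] be; apply: cS.
by apply/flattenP; exists (eq_coefs e) => //; apply: map_f.
Qed.

(** The value [c] is above all constants and all values of the given solution,
and an equation outside the core has on each side a variable that takes this
value. *)
Lemma consistent_core : inhabited F ->
  consistent [set` S]%classic <-> consistent (core_system S).
Proof.
move=> [d]; split=> [[p sp]|[q sq]].
  exists (restrict p); apply/core_solutionsP => e.
  by rewrite in_core => /andP[eS _]; apply: sp.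
have [c cP] :=
  common_bound d (codom q ++ flatten [seq eq_coefs e | e <- enum_fset S]).
(* [extend] gives the value [c] to all variables outside the core. *)
exists (extend c q) => e /= eS.
have := sq; rewrite -{1}(extendK c q) => /core_solutionsP sp.
have [eC|] := boolP (e \in core S); first exact: sp.
rewrite in_core eS /= negb_or !side_knownE => /andP[e1 e2].
apply/(solvesP F_free) => i.
have full t : {subset seq_of_opt (term_coef t) <= eq_coefs e} ->
    ~~ (term_vars t \subset V) -> term_occurs (extend c q) t i = occurs i c.
  move=> te /subsetPn[x xt xV]; apply/idP/idP => [|ci]; last first.
    apply/orP; left; apply/exists_inP; exists x => //; rewrite ffunE.
    by case: pickP => // j /eqP jx; case/negP: xV; apply/core_varP; exists j.
  case/orP=> [/exists_inP[y _]|].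
    rewrite ffunE; case: pickP => // j _; apply: cP.
    by rewrite mem_cat codom_f.
  case ct: (term_coef t) => [b|] //=; apply: cP.
  rewrite mem_cat; apply/orP; right; apply/flattenP; exists (eq_coefs e).
    exact: map_f.
  by apply: te; rewrite ct mem_head.
by rewrite !full // => b bt; rewrite mem_cat bt ?orbT.
Qed.

Lemma solves_var_eq_const (X : finType) (p : {ffun X -> F}) x c :
  solves p (var_eq_const x c) <-> p x = c.
Proof.
rewrite /solves /term_eval /= enum_set1 enum_set0 /=.
by split=> [[]|->].
Qed.

Lemma solutions_split (m : nat) (P : 'I_m -> {ffun 'I_#|V| -> F}) :
  solutions (core_system S) = range P ->
  solutions [set` S]%classic =
  (\bigcup_(i in [set: 'I_m])
     solutions ([set` (S `\` core S)%fset] `|`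
       \bigcup_(j in [set: 'I_#|core_vars S|])
          [set var_eq_const (core_var S j) (P i j)]))%classic.
Proof.
move=> SP; apply/seteqP; split=> p.
  move=> sp.
  have /core_solutionsP : forall e, e \in core S -> solves p e.
    by move=> e; rewrite in_core => /andP[eS _]; apply: sp.
  rewrite SP => -[i _ Pi]; exists i => // e [|[j _ ->]].
    by rewrite /= in_fsetD => /andP[_ eS]; apply: sp.
  by apply/solves_var_eq_const; rewrite Pi ffunE.
move=> [i _ sp] e /= eS; have [eC|eC] := boolP (e \in core S); last first.
  by apply: sp; left; rewrite /= in_fsetD eC.
suff /core_solutionsP : solutions (core_system S) (restrict p) by apply.
rewrite SP; exists i => //; apply/ffunP => j; rewrite ffunE; apply/esym.
by apply/solves_var_eq_const/sp; right; exists j.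
Qed.

End CoreSolutions.

(** * Correctness of the search *)

Lemma Forall2_map (T : eqType) (A B : Type) (R : A -> B -> Prop)
    (f : T -> A) (h : T -> B) (s : seq T) :
  {in s, forall x, R (f x) (h x)} -> List.Forall2 R (map f s) (map h s).
Proof.
elim: s => [|x s IH] Rs; first exact: List.Forall2_nil.
apply: List.Forall2_cons; first by apply: Rs; rewrite mem_head.
by apply: IH => y ys; apply: Rs; rewrite in_cons ys orbT.
Qed.

Lemma Forall2_in (A B : eqType) (R : A -> B -> Prop) s t : List.Forall2 R s t ->
  [/\ size s = size t, {in s, forall x, exists2 y, y \in t & R x y}
    & {in t, forall y, exists2 x, x \in s & R x y}].
Proof.
elim=> [|x y {}s {}t Rxy _ [/= -> st ts]]; first by split.
split=> // [z|z]; rewrite in_cons => /orP[/eqP->|].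
- by exists y; rewrite ?mem_head.
- by case/st => u ut Rzu; exists u; rewrite // in_cons ut orbT.
- by exists x; rewrite ?mem_head.
- by case/ts => u us Ruz; exists u; rewrite // in_cons us orbT.
Qed.

Lemma subwords_subseq s u : u \in subwords s -> subseq u s.
Proof.
elim: s u => [|y s IH] u; first by rewrite inE => /eqP->.
rewrite /subwords /= mem_cat => /orP[/IH us|/mapP[v /IH vs ->]].
  exact: subseq_trans us (subseq_cons _ _).
by rewrite /= eqxx.
Qed.

(** This suffices for completeness: a normal form of an element whose
generators are listed in [s] is obtained by filtering [s]. *)
Lemma filter_subwords (p : pred nat) s : filter p s \in subwords s.
Proof.
elim: s => [|y s IH] //=; rewrite /subwords /= mem_cat.
by case: (p y); [rewrite map_f ?orbT | rewrite IH].
Qed.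

Lemma assignmentsP V U q : q \in assignments V U <->
  map fst q = V /\ {subset map snd q <= U}.
Proof.
elim: V q => [|v V IH] q.
  rewrite inE; split=> [/eqP->|[]]; first by split.
  by case: q.
split=> [/flattenP[l /mapP[u uU ->] /mapP[q' /IH[<- q'U] ->]]|[]].
  split=> // z; rewrite inE => /orP[/eqP->//|]; exact: q'U.
case: q => [//|[v' u] q] [-> qV] qU.
apply/flattenP; exists [seq (v, u) :: q | q <- assignments V U].
  by apply/mapP; exists u => //; apply: qU; rewrite mem_head.
apply: map_f; apply/IH; split=> // z zq; apply: qU.
by rewrite in_cons zq orbT.
Qed.

Lemma mem_value q t l :
  (l \in value q t) =
  has (fun b => (b.1 \in t.1) && (l \in b.2)) q || (l \in t.2).
Proof.
rewrite /value mem_cat; congr (_ || _).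
elim: q => //= b q <-.
by case: (b.1 \in t.1); rewrite //= mem_cat.
Qed.

Lemma mem_generators w l : (l \in generators w) =
  (l \in flatten [seq e.1.2 ++ e.2.2 | e <- w]).
Proof.
rewrite /generators; elim: flatten l => //= y s IH l; rewrite in_cons.
case: ifP => ys; last by rewrite in_cons IH.
by rewrite IH; case: eqP => // ->; rewrite -IH ys.
Qed.

Lemma uniq_generators w : uniq (generators w).
Proof.
by rewrite /generators; elim: flatten => //= y s IH; case: ifP => //= ->.
Qed.

Lemma same_lettersP s t : reflect (s =i t) (same_letters s t).
Proof.
apply: (iffP andP) => [[/allP st /allP ts] x|st].
  by apply/idP/idP; [apply: st|apply: ts].
by split; apply/allP => x; rewrite st.
Qed.

Definition nat_term n r (w : wterm n r) : seq nat * seq nat :=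
  (map val w.1, map val w.2).

Definition nat_equation n r (w : wequation n r) :=
  (nat_term w.1, nat_term w.2).

Definition nat_system n r (w : wsystem n r) := [seq nat_equation v | v <- w].

Lemma encode_seq_map A B (f : B -> tree) (h : A -> B) s :
  encode_seq f (map h s) = encode_seq (fun x => f (h x)) s.
Proof. by elim: s => //= x s ->. Qed.

Lemma encode_nat_system n r (w : wsystem n r) :
  encode (nat_system w) = encode_system w.
Proof.
have E (t : wterm n r) : encode (nat_term t) = encode_term t.
  by rewrite /= /encode_pair /= !encode_seq_map.
rewrite [LHS]/= encode_seq_map; congr encode_seq; apply/funext => v.
by rewrite /encode_pair -!E.
Qed.

Definition to_word r (s : seq nat) : word r := pmap insub s.

Lemma to_wordK r s : all (fun l => l < r) s -> map val (to_word r s) = s.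
Proof.
elim: s => //= l s IH /andP[lr sr].
by rewrite /to_word /= insubT /= -[pmap _ _]/(to_word r s) IH.
Qed.

Lemma encode_points_to_word r (Z : seq (seq (seq nat))) :
  (forall z y, z \in Z -> y \in z -> all (fun l => l < r) y) ->
  encode_points [seq map (to_word r) z | z <- Z] = encode Z.
Proof.
rewrite /encode_points encode_seq_map /=.
elim: Z => //= z Z IH Zr; congr node; last first.
  by apply: IH => z' y zZ; apply: Zr; rewrite in_cons zZ orbT.
move: (Zr z) => {IH Zr}; rewrite encode_seq_map mem_head.
elim: z => //= y z IH zr; congr node; last first.
  by apply: IH => y' _ yz; apply: zr; rewrite // in_cons yz orbT.
rewrite -[in RHS](@to_wordK r y) ?encode_seq_map //.
by apply: zr; rewrite ?mem_head.
Qed.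

Section Correctness.
Variables (I : Type) (F : semilatticeType) (a : I -> F).
Hypothesis F_free : free_semilattice a.
Local Notation occurs := (occurs F_free).
Local Notation term_occurs := (term_occurs F_free).
Variables (n r : nat) (g : 'I_r -> I) (S : {fset equation 'I_n F}).
Variable w : wsystem n r.
Hypothesis g_inj : injective g.
Hypothesis wS : system_normal_form a g w S.
Local Notation V := (core_vars S).
Local Notation W := (nat_system w).
Local Notation enf := (equation_normal_form a g).
Implicit Types (t : wterm n r) (u : fterm 'I_n F) (v : wequation n r).
Implicit Types (e : equation 'I_n F) (R : seq nat) (C : {set 'I_n}).

Lemma occurs_word (z : word r) x i : word_val a g z = Some x ->
  occurs i x <-> exists2 l, l \in z & g l = i.
Proof.
rewrite /word_val => ux; rewrite (occurs_sprod F_free i ux) has_map.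
split=> [/hasP[l lu]|[l lu <-]] /=.
  by rewrite occurs_gen => /asboolP->; exists l.
by apply/hasP; exists l => //=; rewrite occurs_gen; apply/asboolP.
Qed.

Lemma occurs_word_gen (u : word r) x l : word_val a g u = Some x ->
  occurs (g l) x = (l \in u).
Proof.
move=> ux; apply/idP/idP => [/(occurs_word _ ux)[l' ? /g_inj<-]//|lu].
by apply/(occurs_word _ ux); exists l.
Qed.

Lemma system_equations :
  [/\ #|` S| <= size w,
      {in w, forall v, exists2 e, e \in S & enf v e}
    & forall e, e \in S -> exists2 v, v \in w & enf v e].
Proof.
case: wS => es ->/Forall2_in[-> wes esw]; split.
- by rewrite card_fseq size_undup.
- by move=> v /wes[e ees ve]; exists e; rewrite ?inE.
- by move=> e; rewrite inE => /esw.
Qed.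

Lemma mem_term_vars t u (x : 'I_n) : term_normal_form a g t u ->
  (val x \in (nat_term t).1) = (x \in term_vars u).
Proof. by case=> _ <- _ _; rewrite inE mem_map //; apply: val_inj. Qed.

Lemma vars_known t u R C : term_normal_form a g t u ->
  (forall x : 'I_n, (val x \in R) = (x \in C)) ->
  all (fun x => x \in R) (nat_term t).1 = side_known C u.
Proof.
move=> tu RC; rewrite side_knownE; apply/allP/fintype.subsetP => h.
  by move=> x xu; rewrite -RC; apply: h; rewrite (mem_term_vars _ tu).
move=> _ /mapP[x xt ->]; rewrite RC; apply: h.
by rewrite -(mem_term_vars _ tu); apply: map_f.
Qed.

Lemma equation_known v e R C : enf v e ->
  (forall x : 'I_n, (val x \in R) = (x \in C)) ->
  var_sides_known R (nat_equation v) = eq_known C e.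
Proof.
move=> [v1 v2] RC; rewrite /var_sides_known /eq_known.
by rewrite -(vars_known v1 RC) -(vars_known v2 RC).
Qed.

(** The saturation on numbers and the procedure run in parallel. *)
Lemma iter_saturate m :
  all (fun x => x < n) (iter m (saturate W) [::]) /\
  forall x : 'I_n, (val x \in iter m (saturate W) [::]) = (x \in (stage S m).2).
Proof.
have [_ wSi Sw] := system_equations.
elim: m => [|m [Rn RC]]; first by split=> // x; rewrite finset.in_set0.
rewrite iterS; set R := iter m _ _ in Rn RC *; split.
  rewrite all_cat Rn /=; apply/allP => x /flattenP[_ /mapP[d + ->]].
  rewrite mem_filter => /andP[_ /mapP[v _ ->]].
  by rewrite mem_cat => /orP[] /mapP[y _ ->]; apply: ltn_ord.
move=> x; apply/idP/stage_vars; rewrite mem_cat -RC.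
  case/orP=> [->|/flattenP[_ /mapP[d + ->]]]; first by left.
  rewrite mem_filter => /andP[kd /mapP[v vw dv]]; move: kd; rewrite dv.
  have [e eS ve] := wSi v vw; have [v1 v2] := ve.
  rewrite (equation_known ve RC).
  rewrite mem_cat (mem_term_vars x v1) (mem_term_vars x v2) => ke xe; right.
  by exists e; rewrite ?eS // /eq_vars finset.in_setU.
case=> [->//|[e /andP[eS ke]]]; have [v vw ve] := Sw e eS.
rewrite /eq_vars finset.in_setU; case: (ve) => v1 v2.
rewrite -(mem_term_vars x v1) -(mem_term_vars x v2) => xe.
apply/orP; right; apply/flattenP.
exists ((nat_equation v).1.1 ++ (nat_equation v).2.1); last by rewrite mem_cat.
apply/mapP; exists (nat_equation v) => //.
by rewrite mem_filter (equation_known ve RC) ke map_f.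
Qed.

(** The list [w] may present an equation several times, so that the saturation
may go on after the procedure has stopped; this changes nothing. *)
Lemma reached_varsP :
  all (fun x => x < n) (reached_vars W) /\
  forall x : 'I_n, (val x \in reached_vars W) = (x \in V).
Proof.
have [Sw _ _] := system_equations.
rewrite /reached_vars size_map; have [Rn RC] := iter_saturate (size w).
split=> // x; rewrite RC -(subnKC Sw) stage_stable.
by [].
Qed.

Lemma sorted_varsE : sorted_vars W = map val (enum V).
Proof.
have [/allP Rn RC] := reached_varsP.
rewrite /sorted_vars; set R := reached_vars W in Rn RC *.
have le_sumn x : x \in R -> x < (sumn R).+1.
  elim: (R) => //= y s IH; rewrite in_cons ltnS => /orP[/eqP->|/IH].
    exact: leq_addr.
  by rewrite ltnS => /leq_trans; apply; apply: leq_addl.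
apply: (irr_sorted_eq ltn_trans ltnn).
- exact/sorted_filter/iota_ltn_sorted/ltn_trans.
- rewrite /enum_mem -enumT.
  apply: (subseq_sorted ltn_trans _ (iota_ltn_sorted 0 n)).
  by rewrite -val_enum_ord map_subseq ?filter_subseq.
move=> x; rewrite mem_filter mem_iota add0n.
apply/andP/mapP => [[xR _]|[y]].
  exists (Ordinal (Rn x xR)) => //.
  by rewrite mem_enum -RC.
by rewrite mem_enum => yV ->; rewrite RC yV /= le_sumn // RC.
Qed.

Lemma coef_generators v t : v \in w -> t = v.1 \/ t = v.2 ->
  {subset (nat_term t).2 <= generators W}.
Proof.
move=> vw tv l lt; rewrite mem_generators; apply/flattenP.
exists ((nat_equation v).1.2 ++ (nat_equation v).2.2).
  by apply/mapP; exists (nat_equation v) => //; apply: map_f.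
by rewrite mem_cat; case: tv lt => -> ->; rewrite ?orbT.
Qed.

Lemma generators_lt l : l \in generators W -> l < r.
Proof.
rewrite mem_generators => /flattenP[_ /mapP[_ /mapP[v _ ->] ->]].
by rewrite mem_cat => /orP[] /mapP[y _ ->]; apply: ltn_ord.
Qed.

(** An assignment [b] of words to the core variables, as the search produces it,
together with a point [p] whose coordinates these words denote. *)
Section Point.
Variables (b : seq (nat * seq nat)) (p : {ffun 'I_n -> F}).
Hypothesis bV : map fst b = map val (enum V).
Hypothesis br : forall y, y \in map snd b -> all (fun l => l < r) y.
Hypothesis bp : forall j : 'I_#|V|,
  word_val a g (to_word r (nth [::] (map snd b) j)) = Some (p (core_var S j)).

Lemma size_point : size b = #|V|.
Proof. by rewrite -(size_map fst) bV size_map -cardE. Qed.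

Lemma point_nth (j : 'I_#|V|) :
  nth (0, [::]) b j = (val (core_var S j), nth [::] (map snd b) j).
Proof.
have jb : j < size b by rewrite size_point.
rewrite [LHS]surjective_pairing (nth_map (0, [::])) //; congr (_, _).
rewrite -(nth_map _ 0) // bV (nth_map (core_var S j)) -?cardE //.
by rewrite /core_var -enum_val_nth.
Qed.

Lemma occurs_point j (l : 'I_r) :
  occurs (g l) (p (core_var S j)) = (val l \in nth [::] (map snd b) j).
Proof.
rewrite (occurs_word_gen _ (bp j)) -(mem_map val_inj) to_wordK //.
by apply: br; apply: mem_nth; rewrite size_map size_point.
Qed.

Lemma mem_value_term t u (l : 'I_r) : term_normal_form a g t u ->
  term_vars u \subset V ->
  (val l \in value b (nat_term t)) = term_occurs p u (g l).
Proof.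
move=> tu uV; rewrite mem_value /term_occurs; congr (_ || _); last first.
  case: tu => _ _ _; rewrite mem_map; last exact: val_inj.
  case: term_coef => [c|] /=; first by move/occurs_word_gen->.
  by rewrite /word_val; case: t.2.
apply/(has_nthP (0, [::]))/exists_inP => [[j jb]|[x xu]].
  rewrite size_point in jb; rewrite -[j]/(val (Ordinal jb)) point_nth.
  case/andP; rewrite [(_, _).1]/= (mem_term_vars _ tu) => xu lj.
  by exists (core_var S (Ordinal jb)); rewrite ?occurs_point.
have /core_varP[j jx] := fintype.subsetP uV x xu.
rewrite -jx occurs_point => lj; exists j; first by rewrite size_point.
by rewrite point_nth /= lj (mem_term_vars _ tu) jx xu.
Qed.

(** Generators outside the range of [g] occur on neither side, so that comparing
words of numbers below [r] is enough. *)
Lemma term_occurs_gen t u i : term_normal_form a g t u ->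
  term_vars u \subset V -> term_occurs p u i -> exists l, g l = i.
Proof.
move=> [_ _ _ tu] uV /orP[/exists_inP[x xu]|].
  have /core_varP[j <-] := fintype.subsetP uV x xu.
  by move/(occurs_word _ (bp j)) => [l _ <-]; exists l.
case: term_coef tu => [c|] //= tc; move/(occurs_word _ tc) => [l _ <-].
by exists l.
Qed.

Lemma value_lt t x : x \in value b (nat_term t) -> x < r.
Proof.
rewrite mem_value => /orP[/hasP[d db /andP[_ xd]]|/mapP[l _ ->]]; last first.
  exact: ltn_ord.
by apply: (allP (br _)) xd; apply: map_f.
Qed.

Lemma same_letters_solves v e : enf v e -> e \in core S ->
  same_letters (value b (nat_equation v).1) (value b (nat_equation v).2) <->
  solves p e.
Proof.
move=> [v1 v2] /core_eq_vars; rewrite /eq_vars finset.subUset => /andP[V1 V2].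
rewrite (solvesP F_free); split=> [/same_lettersP vv i|se].
  have eqg l : term_occurs p e.1 (g l) = term_occurs p e.2 (g l).
    by rewrite -(mem_value_term l v1 V1) -(mem_value_term l v2 V2) vv.
  apply/idP/idP => oi.
    by have [l li] := term_occurs_gen v1 V1 oi; move: oi; rewrite -li eqg.
  by have [l li] := term_occurs_gen v2 V2 oi; move: oi; rewrite -li eqg.
apply/same_lettersP => x.
suff E (xr : x < r) : (x \in value b (nat_equation v).1)
    = (x \in value b (nat_equation v).2).
  by apply/idP/idP => xv; move: (xv); rewrite E // (value_lt xv).
rewrite -[x]/(val (Ordinal xr)).
by rewrite (mem_value_term _ v1 V1) (mem_value_term _ v2 V2).
Qed.

End Point.

Variable d : F.

(** The default [d] is never taken at a point that the search returns. *)
Definition point_val (z : seq (seq nat)) : {ffun 'I_#|V| -> F} :=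
  [ffun j : 'I_#|V| => odflt d (word_val a g (to_word r (nth [::] z j)))].

(** All that the correctness proof uses about a point found by the search. *)
Lemma core_points_assignment z : z \in core_points W -> exists2 b,
  z = map snd b /\ map fst b = map val (enum V) &
  (forall y, y \in z ->
     [/\ uniq y, all (fun l => l < r) y
       & word_val a g (to_word r y) <> None]) /\
  (forall v e, v \in w -> enf v e -> e \in core S ->
     same_letters (value b (nat_equation v).1) (value b (nat_equation v).2)).
Proof.
case/mapP => b; rewrite mem_filter => /andP[/allP sat /assignmentsP[bV bU]] ->.
exists b; first by rewrite bV sorted_varsE.
split=> [u /bU|v e vw ve eC].
  rewrite mem_filter => /andP[u0 /subwords_subseq ug].
  have ur : all (fun l => l < r) u.
    by apply/allP => l lu; apply/generators_lt/(mem_subseq ug).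
  split=> //; first exact: subseq_uniq ug (uniq_generators _).
  have := to_wordK ur; rewrite /word_val; case: (to_word r u) => //= ue.
  by rewrite -ue in u0.
apply: sat; rewrite mem_filter map_f // andbT.
have [_ RC] := reached_varsP.
by rewrite (equation_known ve RC); move: eC; rewrite in_core => /andP[].
Qed.

Lemma nth_core_points z (j : 'I_#|V|) :
  z \in core_points W -> nth [::] z j \in z.
Proof.
case/core_points_assignment => b [-> bV] _; apply: mem_nth.
by rewrite size_map (size_point bV).
Qed.

Lemma point_valE z (j : 'I_#|V|) : z \in core_points W ->
  word_val a g (to_word r (nth [::] z j)) = Some (point_val z j).
Proof.
move=> zW; have [b _ [zP _]] := core_points_assignment zW.
have [_ _] := zP _ (nth_core_points j zW).
by rewrite ffunE; case: word_val.
Qed.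

Lemma point_val_normal_form z : z \in core_points W ->
  point_normal_form a g (map (to_word r) z) (point_val z).
Proof.
move=> zW; have [b [zb bV] [zP _]] := core_points_assignment zW.
have zE : z = [seq nth [::] z j | j <- map val (enum 'I_#|V|)].
  rewrite val_enum_ord -(size_point bV) -(size_map snd) -zb.
  by rewrite map_nth_iota0 // take_size.
rewrite -map_comp in zE; rewrite /point_normal_form.
rewrite [X in List.Forall2 _ (map _ X)]zE -map_comp.
apply: Forall2_map => j _ /=.
split; last exact: point_valE.
have [uj rj _] := zP _ (nth_core_points j zW).
by rewrite -(map_inj_uniq val_inj) to_wordK.
Qed.

(** Soundness of the search: comparing words by their letters is the same as
comparing the elements that they denote, by [same_letters_solves]. *)
Lemma point_val_solution z : z \in core_points W ->
  solutions (core_system S) (point_val z).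
Proof.
move=> zW; have [b [zb bV] [zP sat]] := core_points_assignment zW.
rewrite -(extendK d (point_val z)); apply/(core_solutionsP F_free) => e eC.
have [_ _ Sw] := system_equations.
have [v vw ve] : exists2 v, v \in w & enf v e.
  by apply: Sw; move: eC; rewrite in_core => /andP[].
apply/(same_letters_solves bV _ _ ve eC); last exact: sat ve eC.
- by move=> u; rewrite -zb => /zP[].
- move=> j; rewrite -zb point_valE //; congr Some.
  by rewrite -[in LHS](extendK d (point_val z)) ffunE.
Qed.

(** Completeness of the search: by [core_solution_bound] the coordinates of a
solution only contain generators that occur in the system, so that each is
denoted by a subword of [generators]. *)
Lemma solution_point_val q : solutions (core_system S) q ->
  exists2 z, z \in core_points W & point_val z = q.
Proof.
rewrite -(extendK d q); set p := extend d q => /(core_solutionsP F_free) sp.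
have [_ wSi Sw] := system_equations.
pose letters j := [seq l <- generators W |
  [exists l' : 'I_r, (val l' == l) && occurs (g l') (p (core_var S j))]].
pose b := [seq (val (core_var S j), letters j) | j <- enum 'I_#|V|].
have b1 : map fst b = [seq val (core_var S j) | j <- enum 'I_#|V|].
  by rewrite /b; elim: (enum _) => //= j s ->.
have b2 : map snd b = [seq letters j | j <- enum 'I_#|V|].
  by rewrite /b; elim: (enum _) => //= j s ->.
have bV : map fst b = map val (enum V).
  rewrite b1; apply: (eq_from_nth (x0 := 0)) => [|i].
    by rewrite [LHS]size_map size_enum_ord [RHS]size_map cardE.
  rewrite size_map size_enum_ord => iV; rewrite -[i]/(val (Ordinal iV)).
  rewrite (nth_map (Ordinal iV)) ?size_enum_ord // nth_ord_enum.
  by rewrite (nth_map (core_var S (Ordinal iV))) -?cardE // -enum_val_nth.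
have bj (j : 'I_#|V|) : nth [::] (map snd b) j = letters j.
  by rewrite b2 (nth_map j) ?size_enum_ord // nth_ord_enum.
have br y : y \in map snd b -> all (fun l => l < r) y.
  rewrite b2 => /mapP[j _ ->]; apply/allP => l.
  by rewrite mem_filter => /andP[_ /generators_lt].
pose K i := exists2 l : 'I_r, val l \in generators W & g l = i.
have pK j i : occurs i (p (core_var S j)) -> K i.
  apply: (core_solution_bound (K := K) sp); last exact: enum_valP.
  move=> e c {}i; rewrite in_core => /andP[/Sw[v vw [v1 v2]] _].
  have coefK t u : t = v.1 \/ t = v.2 -> term_normal_form a g t u ->
      c \in seq_of_opt (term_coef u) -> occurs i c -> K i.
    move=> tv [_ _ _]; case: term_coef => [c'|] //= tc; rewrite inE => /eqP->.
    move/(occurs_word _ tc) => [l lt <-]; exists l => //.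
    by apply: (coef_generators vw tv); apply: map_f.
  rewrite mem_cat => /orP[]; [apply: coefK v1|apply: coefK v2]; first by left.
  by right.
have occurs_letters j (l : 'I_r) :
  (val l \in letters j) = occurs (g l) (p (core_var S j)).
  rewrite mem_filter.
  apply/andP/idP => [[/existsP[l' /andP[/eqP/val_inj-> //]]]|lj].
  split; first by apply/existsP; exists l; rewrite eqxx.
  by have [l' lW /g_inj<-] := pK j _ lj.
have lettersK j : map val (to_word r (letters j)) = letters j.
  apply: to_wordK; apply/allP => l.
  by rewrite mem_filter => /andP[_ /generators_lt].
have bp (j : 'I_#|V|) :
    word_val a g (to_word r (nth [::] (map snd b) j)) = Some (p (core_var S j)).
  have mem_word l :
      (l \in to_word r (letters j)) = occurs (g l) (p (core_var S j)).
    by rewrite -occurs_letters -[in RHS]lettersK mem_map //; apply: val_inj.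
  rewrite bj /word_val.
  rewrite -(@sprod_support _ _ _ F_free _ g (to_word r (letters j))) => [|i oi].
    congr (sprod (map _ _)); apply/esym/all_filterP/allP => l.
    by rewrite mem_word.
  have [l _ li] := pK j i oi.
  by exists l; rewrite // mem_word li.
exists (map snd b); last first.
  by apply/ffunP => j; rewrite [LHS]ffunE bp [RHS]ffunE.
apply: map_f; rewrite mem_filter; apply/andP; split; last first.
  apply/assignmentsP; split; first by rewrite bV sorted_varsE.
  rewrite b2 => _ /mapP[j _ ->] /=; rewrite mem_filter filter_subwords andbT.
  by have := bp j; rewrite bj; case: (letters j).
apply/allP => x; rewrite mem_filter => /andP[+ /mapP[v vw xv]]; rewrite xv.
have [_ RC] := reached_varsP.
have [e eS ve] := wSi v vw; rewrite (equation_known ve RC) => ke.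
have eC : e \in core S by rewrite in_core eS.
exact/(same_letters_solves bV br bp ve eC)/sp.
Qed.

End Correctness.

Theorem theorem6p2 (I : Type) (F : semilatticeType) (a : I -> F)
    (F_free : free_semilattice a) (F_nonempty : inhabited F) :
  (exists c : program, forall (n : nat) (S : {fset equation 'I_n F}),
     finds_core_solutions a c S) /\
  forall (n : nat) (S : {fset equation 'I_n F}),
    [/\ finite_set (solutions (core_system S)),
        consistent [set` S]%classic <-> consistent (core_system S)
      & forall (m : nat) (P : 'I_m -> {ffun 'I_#|core_vars S| -> F}),
          solutions (core_system S) = range P ->
          solutions [set` S]%classic =
          (\bigcup_(i in [set: 'I_m])
             solutions ([set` (S `\` core S)%fset] `|`
               \bigcup_(j in [set: 'I_#|core_vars S|])
                  [set var_eq_const (core_var S j) (P i j)]))%classic].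
Proof.
split=> [|n S]; last first.
  split; first exact: finite_core_solutions F_free _ S F_nonempty.
    exact: consistent_core F_free _ S F_nonempty.
  exact: (solutions_split F_free).
have [d] := F_nonempty; have [c cP] := computable_core_points.
exists c => n S r g w g_inj wS; set W := nat_system w.
exists [seq map (to_word r) z | z <- core_points W].
exists [seq point_val a g S d z | z <- core_points W]; split.
- rewrite encode_points_to_word => [|z y zW yz].
    by rewrite -encode_nat_system; apply: cP.
  by have [b _ [zP _]] := core_points_assignment wS zW; case: (zP y yz).
- by apply: Forall2_map => z zW; apply: (point_val_normal_form wS).
- apply/seteqP; split=> q /=.
    by case/(solution_point_val F_free g_inj wS d) => z zW <-; apply: map_f.
  by case/mapP => z zW ->; apply: (point_val_solution F_free g_inj wS).
Qed.
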